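(* Let $\mathcal{L}$ be a complete modular lattice and let $\mathfrak{m}$ be a submonoid with zero of $\mathrm{End}_{lin}(\mathcal{L})$ that is closed under complements. If $\mathcal{L}$ is $\mathfrak{m}$-$\mathcal{T}$-lifting and satisfies $\mathfrak{m}$-$D_2$, then $\mathfrak{m}/\equiv^\nabla$ is a regular monoid.
   Context: $\mathbf{0},\mathbf{1}$ denote the least and greatest elements; $[a,b]=\{x: a\le x\le b\}$. An element $x$ ''is a complement'' (or ''has a complement'') if there is $x'$ with $x\wedge x'=\mathbf{0}$, $x\vee x'=\mathbf{1}$; $C(\mathcal{L})$ is the set of such elements. An element $x$ of a bounded lattice is superfluous if $x\vee y=\mathbf{1}$ implies $y=\mathbf{1}$ (in an interval $[\mathbf{0},c']$ the top element is $c'$). Linear morphism: a map $\varphi:\mathcal{L}\to\mathcal{L}'$ between bounded lattices is linear if there exist $\ker_\varphi\in\mathcal{L}$ (the kernel) and $a'\in\mathcal{L}'$ such that (1) $\varphi(x)=\varphi(x\vee\ker_\varphi)$ for all $x$; (2) $\varphi$ restricts to a lattice isomorphism $[\ker_\varphi,\mathbf{1}]\to[\mathbf{0},a']$ (so $a'=\varphi(\mathbf{1})$). $\mathrm{End}_{lin}(\mathcal{L})$ is the monoid of linear morphisms $\mathcal{L}\to\mathcal{L}$ under composition; its zero is the constant map $\mathbf{0}$. A submonoid with zero contains the identity and the zero morphism. For $x$ with complement $x'$, the projection $\pi_x$ (with respect to $x'$) is $\pi_x(a)=(a\vee x')\wedge x$, viewed with codomain $\mathcal{L}$ or $[\mathbf{0},x]$;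 $\iota_x:[\mathbf{0},x]\to\mathcal{L}$ is the inclusion; $\rho_a:\mathcal{L}\to[a,\mathbf{1}]$ is $\rho_a(y)=a\vee y$. $\mathfrak{m}$ is closed under complements if for every $\varphi\in\mathfrak{m}$ and all $x,y\in C(\mathcal{L})$ such that $\varphi$ restricts to an isomorphism $\varphi|_x:[\mathbf{0},x]\to[\mathbf{0},y]$, one has $\iota_x(\varphi|_x)^{-1}\pi_y\in\mathfrak{m}$ (for every choice of complement of $y$ defining $\pi_y$). $\mathcal{L}$ is $\mathfrak{m}$-$\mathcal{T}$-lifting if for every $\varphi\in\mathfrak{m}$ there is $c\in C(\mathcal{L})$ with a complement $c'$ such that $c\le\varphi(\mathbf{1})$ and $\varphi(\mathbf{1})\wedge c'$ is superfluous in $[\mathbf{0},c']$. $\mathfrak{m}$-$D_2$: whenever $a,x\in\mathcal{L}$, $x$ is a complement in $\mathcal{L}$, $\theta:[a,\mathbf{1}]\to[\mathbf{0},x]$ is an isomorphism and $\iota_x\theta\rho_a\in\mathfrak{m}$, then $a$ is a complement in $\mathcal{L}$. For $\varphi,\psi\in\mathfrak{m}$, $\varphi\equiv^\nabla\psi$ means: there is a superfluous element $x$ of $\mathcal{L}$ such that $\varphi(a)\vee x=\psi(a)\vee x$ for all $a\in\mathcal{L}$. This is a congruence on $\mathfrak{m}$, and $\mathfrak{m}/\equiv^\nabla$ is the quotient monoid. A monoid $E$ is regular if for every $e\in E$ there is $f\in E$ with $e=efe$. *)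

(* Defs.v *)
From HB Require Import structures.
From mathcomp Require Import all_boot all_order.
From mathcomp Require Import interval generic_quotient.
From mathcomp Require Import boolp classical_sets functions set_interval.

Set Implicit Arguments.
Unset Strict Implicit.
Unset Printing Implicit Defensive.

Import Order.TTheory.
Local Open Scope order_scope.

HB.mixin Record Lattice_isModular d L of Order.Lattice d L := {
  modularUI : forall x y z : L, x <= z -> x `|` (y `&` z) = (x `|` y) `&` z
}.

#[short(type="tbModularLatticeType")]
HB.structure Definition TBModularLattice d :=
  { L of Order.TBLattice d L & Lattice_isModular d L }.

HB.mixin Record Lattice_isComplete d L of Order.Lattice d L := {
  ex_supremum : forall A : set L, exists s, supremums A s;
  ex_infimum : forall A : set L, exists s, infimums A s
}.

#[short(type="completeModularLatticeType")]
HB.structure Definition CompleteModularLattice d :=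
  { L of TBModularLattice d L & Lattice_isComplete d L }.

(* In a lattice the closed interval [a, b] is the set `[a, b]%classic.  Maps
   between intervals are total functions on the ambient lattices, of which only
   the restriction to the interval matters. *)
Definition lattice_iso_on d d' (L : latticeType d) (L' : latticeType d')
    (A : set L) (B : set L') (f : L -> L') : Prop :=
  [/\ set_bij A B f,
      {in A &, {morph f : x y / x `&` y}} &
      {in A &, {morph f : x y / x `|` y}}].

Definition linear_morphism d d' (L : tbLatticeType d) (L' : tbLatticeType d')
    (f : L -> L') : Prop :=
  exists (k : L) (a' : L'),
    (forall x, f x = f (x `|` k)) /\
    lattice_iso_on `[k, \top]%classic `[\bot, a']%classic f.

Section Elements.
Context d (L : tbLatticeType d).
Implicit Types (x y b : L) (f g : L -> L).

Definition is_complement x y : Prop := x `&` y = \bot /\ x `|` y = \top.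

Definition complemented x : Prop := exists x', is_complement x x'.

Definition superfluous_in b x : Prop :=
  x <= b /\ forall y, y <= b -> x `|` y = b -> y = b.

Definition superfluous x : Prop := forall y, x `|` y = \top -> y = \top.

Definition proj x x' : L -> L := fun a => (a `|` x') `&` x.

Definition nabla_equiv f g : Prop :=
  exists x, superfluous x /\ forall a, f a `|` x = g a `|` x.

End Elements.

Record lin_submonoid d (L : tbLatticeType d) := LinSubmonoid {
  lin_carrier :> set (L -> L);
  lin_linear : forall f, lin_carrier f -> linear_morphism f;
  lin_id : lin_carrier id;
  lin_zero : lin_carrier (fun=> \bot);
  lin_comp : forall f g, lin_carrier f -> lin_carrier g -> lin_carrier (f \o g)
}.

Section Conditions.
Context d (L : tbLatticeType d) (m : lin_submonoid L).

(* 'pinv_dflt A f is the inverse of f restricted to A; the default value \bot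
   is never used, since proj y y' takes values in `[\bot, y]. *)
Definition closed_under_complements : Prop :=
  forall (f : L -> L) (x y : L), lin_carrier m f -> complemented x -> complemented y ->
    lattice_iso_on `[\bot, x]%classic `[\bot, y]%classic f ->
    forall y', is_complement y y' ->
      lin_carrier m ('pinv_(fun=> \bot) `[\bot, x]%classic f \o proj y y').

Definition T_lifting : Prop :=
  forall f : L -> L, lin_carrier m f ->
    exists c c' : L, [/\ is_complement c c', c <= f \top &
                         superfluous_in c' (f \top `&` c')].

Definition D2 : Prop :=
  forall (a x : L) (theta : L -> L), complemented x ->
    lattice_iso_on `[a, \top]%classic `[\bot, x]%classic theta ->
    lin_carrier m (fun y => theta (a `|` y)) -> complemented a.

End Conditions.

Definition regular_monoid (E : monoidType) : Prop :=
  forall e : E, exists f : E, e = (e * f * e)%g.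

Definition lin_elt d (L : tbLatticeType d) (m : lin_submonoid L) : Type :=
  set_type m.

Section LinMonoid.
Context d (L : tbLatticeType d) (m : lin_submonoid L).

HB.instance Definition _ := Choice.on (lin_elt m).

Definition lin_fun (f : lin_elt m) : L -> L := val f.

Lemma lin_funP (f : lin_elt m) : lin_carrier m (lin_fun f).
Proof. exact: set_valP. Qed.

Lemma lin_fun_inj : injective lin_fun.
Proof. exact: val_inj. Qed.

Definition lin_mk (f : L -> L) (mf : lin_carrier m f) : lin_elt m := exist _ f (mem_set mf).

Definition lin_one : lin_elt m := lin_mk (lin_id m).

Definition lin_mul (f g : lin_elt m) : lin_elt m :=
  lin_mk (lin_comp (lin_funP f) (lin_funP g)).

Fact lin_mulA : associative lin_mul.
Proof. by move=> f g h; apply: lin_fun_inj. Qed.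

Fact lin_mul1 : left_id lin_one lin_mul.
Proof. by move=> f; apply: lin_fun_inj. Qed.

Fact lin_1mul : right_id lin_one lin_mul.
Proof. by move=> f; apply: lin_fun_inj. Qed.

HB.instance Definition _ :=
  isMonoid.Build (lin_elt m) lin_mulA lin_mul1 lin_1mul.

End LinMonoid.

Section Congruence.
Context d (L : tbModularLatticeType d).
Implicit Types (x y : L) (f g : L -> L).

Lemma superfluousU x y : superfluous x -> superfluous y -> superfluous (x `|` y).
Proof. by move=> sx sy z; rewrite -joinA => /sx/sy. Qed.

Lemma linear_morphismU f : linear_morphism f -> {morph f : x y / x `|` y}.
Proof.
move=> [k [a' [fk [_ _ fU]]]] x y.
have kz z : z `|` k \in `[k, \top]%classic by rewrite inE set_itvcc /= leUr lex1.
by rewrite fk (fk x) (fk y) -fU ?kz // joinACA joinxx.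
Qed.

Lemma linear_morphism_superfluous f x :
  linear_morphism f -> superfluous x -> superfluous (f x).
Proof.
move=> lf sx y fxy; have fU := linear_morphismU lf.
case: lf => k [a' [fk [[fB fI fS] _ _]]].
have fle z : f z <= a'.
  have: `[k, \top]%classic (z `|` k) by rewrite set_itvcc /= leUr lex1.
  by move=> /fB; rewrite -fk set_itvcc /= => /andP[].
have f1 : f \top = a'.
  have [|t _ ft] := fS a'; first by rewrite set_itvcc /= le0x lexx.
  by apply/le_anti; rewrite fle -[X in X <= _]ft -(join1x t) fU leUr.
have [|z] := fS (y `&` a'); first by rewrite set_itvcc /= le0x leIr.
rewrite set_itvcc /= => /andP[kz _] fz.
have fxz : f (x `|` z) = f \top by rewrite fU fz modularUI // fxy meet1x f1.
have xz1 : x `|` z = \top.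
  apply: (fI _ _ _ _ fxz); rewrite inE set_itvcc /= ?lexx lex1 //.
  by rewrite lexU2 ?kz ?orbT.
have ya : y `&` a' = a' by rewrite -fz (sx z xz1) f1.
rewrite -fxy; apply/esym/join_idPr; rewrite (le_trans (fle x)) //.
by rewrite -ya leIl.
Qed.

Lemma nabla_equiv_comp f f' g g' : linear_morphism f ->
  nabla_equiv f f' -> nabla_equiv g g' -> nabla_equiv (f \o g) (f' \o g').
Proof.
move=> lf [x [sx ff']] [y [sy gg']]; have fU := linear_morphismU lf.
exists (f y `|` x); split=> [|a].
  exact/superfluousU/sx/linear_morphism_superfluous.
by rewrite /= joinA -fU gg' fU joinAC ff' -joinA (joinC x).
Qed.

Lemma nabla_equiv_refl f : nabla_equiv f f.
Proof. by exists \bot; split=> // y; rewrite join0x. Qed.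

Lemma nabla_equiv_sym f g : nabla_equiv f g -> nabla_equiv g f.
Proof. by move=> [x [sx fg]]; exists x; split. Qed.

Lemma nabla_equiv_trans f g h :
  nabla_equiv f g -> nabla_equiv g h -> nabla_equiv f h.
Proof.
move=> [x [sx fg]] [y [sy gh]]; exists (x `|` y).
split=> [|a]; first exact: superfluousU.
by rewrite joinA fg joinAC gh joinAC -joinA.
Qed.

End Congruence.

Local Open Scope quotient_scope.

Section NablaQuotient.
Context d (L : tbModularLatticeType d) (m : lin_submonoid L).

Definition nabla_rel : rel (lin_elt m) :=
  fun f g => `[< nabla_equiv (lin_fun f) (lin_fun g) >].

Fact nabla_rel_refl : reflexive nabla_rel.
Proof. by move=> f; apply/asboolP/nabla_equiv_refl. Qed.

Fact nabla_rel_sym : symmetric nabla_rel.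
Proof. by move=> f g; apply/asboolP/asboolP; apply: nabla_equiv_sym. Qed.

Fact nabla_rel_trans : transitive nabla_rel.
Proof.
move=> g f h /asboolP fg /asboolP gh.
exact/asboolP/(nabla_equiv_trans fg gh).
Qed.

Canonical nabla_equiv_rel :=
  EquivRel nabla_rel nabla_rel_refl nabla_rel_sym nabla_rel_trans.

Definition nabla_quotient : Type := {eq_quot nabla_equiv_rel}.

HB.instance Definition _ := Choice.on nabla_quotient.
HB.instance Definition _ : EqQuotient _ nabla_equiv_rel nabla_quotient :=
  EqQuotient.on nabla_quotient.

Definition nabla_mul : nabla_quotient -> nabla_quotient -> nabla_quotient :=
  lift_op2 nabla_quotient (fun f g : lin_elt m => (f * g)%g).

Definition nabla_one : nabla_quotient := \pi_nabla_quotient 1%g.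

Fact pi_nabla_mul :
  {morph \pi_nabla_quotient : f g / (f * g)%g >-> nabla_mul f g}.
Proof.
move=> f g; unlock nabla_mul; apply/eqmodP/asboolP.
apply: nabla_equiv_comp; first exact/lin_linear/lin_funP.
- by apply/asboolP; rewrite -[X in is_true X]/(nabla_equiv_rel _ _) -eqmodE reprK.
- by apply/asboolP; rewrite -[X in is_true X]/(nabla_equiv_rel _ _) -eqmodE reprK.
Qed.

Fact nabla_mulA : associative nabla_mul.
Proof.
elim/quotW=> f; elim/quotW=> g; elim/quotW=> h.
by rewrite -!pi_nabla_mul mulgA.
Qed.

Fact nabla_mul1 : left_id nabla_one nabla_mul.
Proof. by elim/quotW=> f; rewrite -pi_nabla_mul mul1g. Qed.

Fact nabla_1mul : right_id nabla_one nabla_mul.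
Proof. by elim/quotW=> f; rewrite -pi_nabla_mul mulg1. Qed.

HB.instance Definition _ :=
  isMonoid.Build nabla_quotient nabla_mulA nabla_mul1 nabla_1mul.

End NablaQuotient.

(* Main.v *)
Require Import Defs.
From mathcomp Require Import all_boot all_order.
From mathcomp Require Import interval generic_quotient.
From mathcomp Require Import boolp classical_sets functions set_interval.

(** Only the part of an endomorphism [f] that lands in a direct summand can be
    inverted on the nose, and the lifting condition says that this part is all
    of [f] up to a superfluous element.  Lifting gives complements [c], [c']
    with [c <= f 1] and [s := f 1 /\ c'] superfluous.  The composite
    [g := proj c c' \o f] lies in [m] and maps onto the interval [0, c], so D2
    makes its kernel [k] complemented, say by [k'].  By modularity (the diamond
    isomorphism) [g] is then an isomorphism from [0, k'] to [0, c], and closure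
    under complements puts [h], its inverse preceded by [proj c c'], in [m].

    By construction [g (h (f t)) = g t], that is, [f (h (f t))] and [f t] have
    the same projection to [c] along [c'], hence the same join with [c']
    ([proj_eq_joinr]).  Both lie below [f 1], so cutting these joins by [f 1]
    and using modularity turns this into equality of the joins with [s]
    ([join_cut]): [f \o h \o f] and [f] are identified by the congruence. *)

Set Implicit Arguments.
Unset Strict Implicit.
Unset Printing Implicit Defensive.

Import Order.TTheory.
Local Open Scope order_scope.
Local Open Scope quotient_scope.

Section Projection.
Context d (L : tbModularLatticeType d).
Implicit Types (b k x y u v s : L) (f : L -> L).

Lemma is_complementC x y : is_complement x y -> is_complement y x.
Proof. by move=> [I U]; split; rewrite 1?meetC 1?joinC. Qed.

Lemma joinr_proj x x' u : is_complement x x' -> x' `|` proj x x' u = u `|` x'.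
Proof.
by move=> [_ U]; rewrite /proj meetC modularUI ?leUr // joinC U meet1x.
Qed.

Lemma proj_eq_joinr x x' u v : is_complement x x' ->
  proj x x' u = proj x x' v -> u `|` x' = v `|` x'.
Proof. by move=> cx uv; rewrite -!(joinr_proj _ cx) uv. Qed.

Lemma proj_id x x' u : is_complement x x' -> u <= x -> proj x x' u = u.
Proof. by move=> [I _] ux; rewrite /proj -modularUI // meetC I joinx0. Qed.

Lemma join_cut u b x : u <= b -> u `|` (b `&` x) = (u `|` x) `&` b.
Proof. by move=> ub; rewrite meetC modularUI. Qed.

(** If [s \/ y] is the top of the whole lattice then, by modularity,
    [s \/ (y /\ b)] is the top [b] of the interval; so [y /\ b = b], and [y]
    lies above [b], hence above [s]. *)
Lemma superfluous_in_superfluous b s : superfluous_in b s -> superfluous s.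
Proof.
move=> [sb ss] y sy1.
have /(ss _ (leIr _ _))/meet_idPr by_ : s `|` (y `&` b) = b.
  by rewrite modularUI // sy1 meet1x.
by rewrite -sy1; apply/esym/join_idPr/(le_trans sb).
Qed.

Lemma in_itv0 x u : (u \in `[\bot, x]%classic) = (u <= x).
Proof. by apply/idP/idP; rewrite inE set_itvcc /= le0x. Qed.

Lemma in_itv1 x u : (u \in `[x, \top]%classic) = (x <= u).
Proof. by apply/idP/idP; rewrite inE set_itvcc /= lex1 andbT. Qed.

Lemma linear_morphism_mono f x y :
  linear_morphism f -> x <= y -> f x <= f y.
Proof.
by move=> /linear_morphismU fU /join_idPr xy; rewrite -xy fU leUl.
Qed.

(** The upper end of the image interval is forced to be the image of the
    top, so the codomain of a linear morphism can be computed. *)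
Lemma linear_morphismP f : linear_morphism f ->
  exists k, (forall x, f x = f (x `|` k)) /\
    lattice_iso_on `[k, \top]%classic `[\bot, f \top]%classic f.
Proof.
move=> lf; have fmono := linear_morphism_mono lf.
case: lf => k [b [fk fiso]]; exists k; split=> //.
suff -> : f \top = b by [].
case: fiso => [[fB _ fS] _ _]; apply/le_anti/andP; split.
  by rewrite -in_itv0 inE; apply: fB; rewrite -inE in_itv1 lex1.
by have [|t _ <-] := fS b; rewrite ?fmono ?lex1 // -inE in_itv0.
Qed.

(** The diamond isomorphism: for a complement [k'] of the kernel [k], the
    interval [0, k'] is a copy of [k, 1] through [x |-> x \/ k]. *)
Lemma iso_on_kernel_complement f k k' b : is_complement k k' ->
  (forall x, f x = f (x `|` k)) ->
  lattice_iso_on `[k, \top]%classic `[\bot, b]%classic f ->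
  lattice_iso_on `[\bot, k']%classic `[\bot, b]%classic f.
Proof.
move=> ck fk [[fB fI fS] fM fJ]; have ck' := is_complementC ck.
have kle x : x `|` k \in `[k, \top]%classic by rewrite in_itv1 leUr.
have projK x : x <= k' -> (x `|` k) `&` k' = x := proj_id ck'.
have fx_proj t : f (proj k' k t) = f t.
  by rewrite fk joinC joinr_proj // -fk.
split; [split| |] => [x _|x y|z zb|x y|x y]; rewrite ?in_itv0.
- by rewrite fk; apply: fB; rewrite -inE.
- move=> xk' yk'; rewrite fk (fk y) => /(fI _ _ (kle x) (kle y)) xy.
  by rewrite -(projK x) // xy projK.
- have [t _ <-] := fS z zb; exists (proj k' k t) => //.
  by rewrite -inE in_itv0 leIr.
- move=> xk' yk'; rewrite [f x]fk [f y]fk -fM //.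
  have -> : x `&` y = proj k' k ((x `|` k) `&` (y `|` k)); last exact: fx_proj.
  rewrite /proj (join_idPl _) ?lexI ?leUr //.
  by rewrite -[in LHS](projK x) // -[in LHS](projK y) // meetACA meetxx.
- by move=> _ _; rewrite fk (fk x) (fk y) -fJ // joinACA joinxx.
Qed.

End Projection.

Section Submonoid.
Context d (L : tbModularLatticeType d) (m : lin_submonoid L).
Implicit Types (f : L -> L).

(** The projection is what closure under complements yields for the identity
    of [m]. *)
Lemma closed_under_complements_proj (c c' : L) : closed_under_complements m ->
  is_complement c c' -> lin_carrier m (proj c c').
Proof.
move=> cm cc; have cC : complemented c by exists c'.
suff <- : 'pinv_(fun=> \bot) `[\bot, c]%classic id \o proj c c' = proj c c'.
  apply: (cm _ _ _ (lin_id m) cC cC _ _ cc).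
  by split=> //; split=> // x; exists x.
apply/funext => x /=; apply: (@pinvKV _ _ _ _ id); first by move=> ? ?.
by rewrite in_itv0 leIr.
Qed.

(** Regularity already holds for maps, with [nabla_equiv] in place of
    equality; passing to the quotient adds nothing more. *)
Lemma T_lifting_D2_regular f :
  closed_under_complements m -> T_lifting m -> D2 m -> lin_carrier m f ->
  exists2 h, lin_carrier m h & nabla_equiv f (f \o h \o f).
Proof.
move=> cm liftm d2 mf; have lf := lin_linear mf.
have [c [c' [cc cf ss]]] := liftm f mf; have cC : complemented c by exists c'.
pose g := proj c c' \o f.
have mg : lin_carrier m g.
  by apply: lin_comp => //; apply: closed_under_complements_proj.
have g1 : g \top = c.
  rewrite /g /= /proj (_ : _ `|` c' = \top) ?meet1x //.
  by apply/le_anti; rewrite lex1 /= -[X in X <= _](proj2 cc) leU2.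
have [k [gk giso]] := linear_morphismP (lin_linear mg).
rewrite g1 in giso.
have [k' ck] : complemented k.
  apply: (d2 k c g cC giso).
  by rewrite (_ : (fun y => _) = g) //; apply/funext => y; rewrite joinC -gk.
have gbij := iso_on_kernel_complement ck gk giso.
have k'C : complemented k' by exists k; apply: is_complementC.
have mh := cm g k' c mg k'C cC gbij c' cc.
set h := _ \o proj c c' in mh.
exists h => //; exists (f \top `&` c'); split.
  exact: superfluous_in_superfluous ss.
move=> t; rewrite /= !join_cut ?linear_morphism_mono ?lex1 //.
congr (_ `&` _); apply/(proj_eq_joinr cc)/esym.
(* [h (f t)] is the preimage of [g t] in [0, k'] *)
have [[_ _ gS] _ _] := gbij.
by rewrite -[LHS]/(g (h (f t))) /h /= (surjpK _ gS) // in_itv0 leIr.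
Qed.

End Submonoid.

Theorem theorem4p19 (d : Order.disp_t) (L : completeModularLatticeType d)
    (m : lin_submonoid L) :
  closed_under_complements m -> T_lifting m -> D2 m ->
  regular_monoid (nabla_quotient m).
Proof.
move=> cm liftm d2; elim/quotW=> f.
have [h mh fhf] := T_lifting_D2_regular cm liftm d2 (lin_funP f).
exists (\pi_(nabla_quotient m) (lin_mk mh)).
rewrite -[(_ * _ * _)%g]/(nabla_mul (nabla_mul _ _) _) -!pi_nabla_mul.
exact/eqmodP/asboolP.
Qed.
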